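(* Let $x\in\mathbb{R}$ be irrational. Then the set $\Gamma(x)'=\{\gamma'_1,\gamma'_2,\gamma'_3,\ldots\}\subset\Gamma$ equals $W'\setminus W'_1$, where $$W'=\{\gamma\in\Gamma\mid \gamma(\infty)\leq-1,\ \gamma(x)>0\},\qquad W'_1=\{\gamma\in W'\mid \gamma(\infty)=-1,\ \det(\gamma)=1\}.$$ Moreover, $W'_1$ has exactly one element.
   Context: $\Gamma=\mathrm{PGL}_2(\mathbb{Z})$ acts on $\mathbb{P}^1(\mathbb{R})=\mathbb{R}\cup\{\infty\}$ by $\begin{pmatrix}a&b\\c&d\end{pmatrix}x=\frac{ax+b}{cx+d}$; the determinant $\det(\gamma)\in\{\pm1\}$ is well defined on $\Gamma$. Let $\varepsilon=\begin{pmatrix}0&1\\1&0\end{pmatrix}$ and $T=\begin{pmatrix}1&1\\0&1\end{pmatrix}$. The slow continued fraction algorithm is: $x_0=x$ and $x_{i+1}=x_i+1=T(x_i)$ if $x_i\leq0$; $x_{i+1}=\frac1{x_i}-1=T^{-1}\varepsilon(x_i)$ if $0<x_i\leq1$; $x_{i+1}=x_i-1=T^{-1}(x_i)$ if $x_i>1$. Correspondingly define $\gamma'_0=\mathrm{Id}$ and $\gamma'_{i+1}=T\gamma'_i$ if $x_i\leq0$, $\gamma'_{i+1}=T^{-1}\varepsilon\gamma'_i$ if $0<x_i\leq1$, $\gamma'_{i+1}=T^{-1}\gamma'_i$ if $x_i>1$, so that $x_i=\gamma'_i(x)$. Set $\Gamma(x)'=\{\gamma'_1,\gamma'_2,\ldots\}$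 (as an unordered set). The condition $\gamma(\infty)\leq-1$ in particular requires $\gamma(\infty)\neq\infty$.
   Formalization: The printed equality fails for x<0 or x>1, since γ'_1=T or T^{-1} fixes ∞ and is not in W'. Proved instead: the equality for 0<x<1; for every irrational x, Γ(x)' without its elements fixing ∞ equals W'∖W'_1; W'_1 has exactly one element for every irrational x. *)

(* Defs.v *)
From HB Require Import structures.
From mathcomp Require Import all_boot all_order all_algebra.
From mathcomp Require Import generic_quotient.
From mathcomp Require Import all_classical reals.
Set Implicit Arguments.
Unset Strict Implicit.
Unset Printing Implicit Defensive.
Import Order.TTheory GRing.Theory Num.Theory.
Local Open Scope ring_scope.
Local Open Scope quotient_scope.
Local Open Scope classical_set_scope.

Record GL2Z := MkGL2Z { glmx :> 'M[int]_2; glmxP : glmx \in unitmx }.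
HB.instance Definition _ := [isSub for glmx].
HB.instance Definition _ := [Choice of GL2Z by <:].

Lemma gl_mul_unit (A B : GL2Z) : glmx A *m glmx B \in unitmx.
Proof. by rewrite unitmx_mul !glmxP. Qed.
Lemma gl_inv_unit (A : GL2Z) : invmx (glmx A) \in unitmx.
Proof. by rewrite unitmx_inv glmxP. Qed.

Definition gl_one : GL2Z := MkGL2Z (unitmx1 int 2).
Definition gl_mul (A B : GL2Z) : GL2Z := MkGL2Z (gl_mul_unit A B).
Definition gl_inv (A : GL2Z) : GL2Z := MkGL2Z (gl_inv_unit A).

Lemma gl_mulA : associative gl_mul.
Proof. by move=> A B C; apply: val_inj; rewrite /= mulmxA. Qed.
Lemma gl_mul1 : left_id gl_one gl_mul.
Proof. by move=> A; apply: val_inj; rewrite /= mul1mx. Qed.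
Lemma gl_mulr1 : right_id gl_one gl_mul.
Proof. by move=> A; apply: val_inj; rewrite /= mulmx1. Qed.
Lemma gl_mulV : left_inverse gl_one gl_inv gl_mul.
Proof. by move=> A; apply: val_inj; rewrite /= mulVmx ?glmxP. Qed.
Lemma gl_mulrV : right_inverse gl_one gl_inv gl_mul.
Proof. by move=> A; apply: val_inj; rewrite /= mulmxV ?glmxP. Qed.
HB.instance Definition _ :=
  isGroup.Build GL2Z gl_mulA gl_mul1 gl_mulr1 gl_mulV gl_mulrV.

Definition pm_eq : rel GL2Z :=
  fun A B => (glmx A == glmx B) || (glmx A == - glmx B).

Lemma pm_eqP (A B : GL2Z) :
  reflect (glmx A = glmx B \/ glmx A = - glmx B) (pm_eq A B).
Proof. by apply: (iffP orP) => -[/eqP|/eqP]; auto. Qed.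

Lemma pm_eq_refl : reflexive pm_eq.
Proof. by move=> A; apply/pm_eqP; left. Qed.
Lemma pm_eq_sym : symmetric pm_eq.
Proof.
by move=> A B; apply/pm_eqP/pm_eqP => -[] ->; rewrite ?opprK; auto.
Qed.
Lemma pm_eq_trans : transitive pm_eq.
Proof.
move=> B A C /pm_eqP AB /pm_eqP BC; apply/pm_eqP.
by case: AB => ->; case: BC => ->; rewrite ?opprK; auto.
Qed.
Canonical pm_eq_equiv := EquivRel pm_eq pm_eq_refl pm_eq_sym pm_eq_trans.

(* PGL_2(Z) as GL_2(Z) modulo its centre {1, -1}. *)
Definition PGL2Z := {eq_quot pm_eq}.
HB.instance Definition _ := Choice.on PGL2Z.
HB.instance Definition _ := Quotient.on PGL2Z.

Definition pgl (A : GL2Z) : PGL2Z := \pi_PGL2Z A.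

Lemma pglP (A B : GL2Z) : pgl A = pgl B <-> pm_eq A B.
Proof. by split=> /(@eqmodP _ pm_eq_equiv). Qed.
Lemma pgl_repr (g : PGL2Z) : pgl (repr g) = g.
Proof. exact: reprK. Qed.
Lemma repr_pgl (A : GL2Z) : pm_eq (repr (pgl A)) A.
Proof. by apply/pglP; rewrite pgl_repr. Qed.

(* The operations, the determinant and the action below are computed on a
   representative; the lemmas pgl_mulE, pgl_invE, pgl_detE and pgl_actE show
   that the choice does not matter. *)
Definition pgl_one : PGL2Z := pgl gl_one.
Definition pgl_mul (g h : PGL2Z) : PGL2Z := pgl (gl_mul (repr g) (repr h)).
Definition pgl_inv (g : PGL2Z) : PGL2Z := pgl (gl_inv (repr g)).

Lemma pgl_mulE (A B : GL2Z) : pgl_mul (pgl A) (pgl B) = pgl (gl_mul A B).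
Proof.
apply/pglP/pm_eqP => /=.
case/pm_eqP: (repr_pgl A) => ->; case/pm_eqP: (repr_pgl B) => ->;
  rewrite ?(mulNmx, mulmxN, opprK); auto.
Qed.
Lemma invmxN2 (A : 'M[int]_2) : A \in unitmx -> invmx (- A) = - invmx A.
Proof.
move=> uA; have uN : - A \in unitmx by rewrite -scaleN1r unitmxZ.
rewrite -[LHS]mulmx1 -(mulmxV uA) -[A *m _]opprK -mulNmx -mulmxN mulmxA.
by rewrite mulVmx // mul1mx.
Qed.
Lemma pgl_invE (A : GL2Z) : pgl_inv (pgl A) = pgl (gl_inv A).
Proof.
apply/pglP/pm_eqP => /=.
by case/pm_eqP: (repr_pgl A) => ->; rewrite ?invmxN2 ?glmxP; auto.
Qed.

Lemma pgl_mulA : associative pgl_mul.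
Proof.
move=> g h k; rewrite -(pgl_repr g) -(pgl_repr h) -(pgl_repr k).
by rewrite !pgl_mulE gl_mulA.
Qed.
Lemma pgl_mul1 : left_id pgl_one pgl_mul.
Proof. by move=> g; rewrite -(pgl_repr g) pgl_mulE gl_mul1. Qed.
Lemma pgl_mulr1 : right_id pgl_one pgl_mul.
Proof. by move=> g; rewrite -(pgl_repr g) pgl_mulE gl_mulr1. Qed.
Lemma pgl_mulV : left_inverse pgl_one pgl_inv pgl_mul.
Proof.
by move=> g; rewrite -(pgl_repr g) pgl_invE pgl_mulE gl_mulV.
Qed.
Lemma pgl_mulrV : right_inverse pgl_one pgl_inv pgl_mul.
Proof.
by move=> g; rewrite -(pgl_repr g) pgl_invE pgl_mulE gl_mulrV.
Qed.
HB.instance Definition _ :=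
  isGroup.Build PGL2Z pgl_mulA pgl_mul1 pgl_mulr1 pgl_mulV pgl_mulrV.

Definition pgl_det (g : PGL2Z) : int := \det (glmx (repr g)).

Lemma pgl_detE (A : GL2Z) : pgl_det (pgl A) = \det (glmx A).
Proof.
by rewrite /pgl_det; case/pm_eqP: (repr_pgl A) => ->;
  rewrite // -scaleN1r detZ expr2 mulrNN !mul1r.
Qed.

Variant P1 (R : Type) : Type := Fin of R | Infty.
Arguments Infty {R}.

Section Action.
Variable R : realType.

Definition gl_act (A : GL2Z) (p : P1 R) : P1 R :=
  let a : R := (glmx A 0 0)%:~R in let b : R := (glmx A 0 1)%:~R in
  let c : R := (glmx A 1 0)%:~R in let d : R := (glmx A 1 1)%:~R in
  match p with
  | Fin y => if c * y + d == 0 then Infty else Fin ((a * y + b) / (c * y + d))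
  | Infty => if c == 0 then Infty else Fin (a / c)
  end.

Definition pgl_act (g : PGL2Z) (p : P1 R) : P1 R := gl_act (repr g) p.

Lemma pgl_actE (A : GL2Z) (p : P1 R) : pgl_act (pgl A) p = gl_act A p.
Proof.
rewrite /pgl_act /gl_act; case/pm_eqP: (repr_pgl A) => -> //.
case: p => [y|]; rewrite !mxE !mulrNz.
  by rewrite !mulNr -!opprD oppr_eq0 invrN mulrNN.
by rewrite oppr_eq0 invrN mulrNN.
Qed.

(* Both comparisons are false at Infty. *)
Definition P1_le (p : P1 R) (r : R) : Prop := exists2 y, p = Fin y & y <= r.
Definition P1_gt (p : P1 R) (r : R) : Prop := exists2 y, p = Fin y & r < y.

End Action.

Definition mx22 (a b c d : int) : 'M[int]_2 :=
  \matrix_(i, j) if i == 0 then (if j == 0 then a else b)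
                 else (if j == 0 then c else d).

Lemma det_mx22 (a b c d : int) : \det (mx22 a b c d) = a * d - b * c.
Proof.
rewrite (expand_det_row _ 0) !big_ord_recl big_ord0 /cofactor !det_mx11 !mxE /=.
by rewrite addr0 mul1r expr1 mulN1r mulrN.
Qed.

Lemma T_unit : mx22 1 1 0 1 \in unitmx.
Proof. by rewrite unitmxE det_mx22. Qed.
Lemma eps_unit : mx22 0 1 1 0 \in unitmx.
Proof. by rewrite unitmxE det_mx22. Qed.

Definition pglT : PGL2Z := pgl (MkGL2Z T_unit).
Definition pglEps : PGL2Z := pgl (MkGL2Z eps_unit).

Section SlowContinuedFraction.
Variable R : realType.

Definition slow_map (y : R) : R :=
  if y <= 0 then y + 1 else if y <= 1 then y^-1 - 1 else y - 1.
Definition slow_seq (x : R) (i : nat) : R := iter i slow_map x.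

Definition slow_letter (y : R) : PGL2Z :=
  if y <= 0 then pglT
  else if y <= 1 then (pglT^-1 * pglEps)%g
  else (pglT^-1)%g.
Fixpoint slow_elt (x : R) (i : nat) : PGL2Z :=
  if i is j.+1 then (slow_letter (slow_seq x j) * slow_elt x j)%g else 1%g.

Definition slow_set (x : R) : set PGL2Z :=
  [set g | exists2 i : nat, (1 <= i)%N & g = slow_elt x i].

Definition W (x : R) : set PGL2Z :=
  [set g | P1_le (pgl_act g Infty) (-1 : R) /\ P1_gt (pgl_act g (Fin x)) 0].
Definition W1 (x : R) : set PGL2Z :=
  [set g | W x g /\ pgl_act g Infty = Fin (-1 : R) /\ pgl_det g = 1].

(* When x <= 0 or x > 1 the algorithm starts with translations, so the first
   few slow_elt x i fix Infty and do not lie in W x; for 0 < x < 1 there are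
   none.  Comparing slow_set x with W x for all x requires removing them. *)
Definition stab_infty : set PGL2Z :=
  [set g | pgl_act g Infty = Infty :> P1 R].

End SlowContinuedFraction.

(* Main.v *)
(* Write p = g(oo) and y = g(x).  One step of the algorithm applied to an
   element of W \ W1 stays in W \ W1, since p <= -1 becomes p - 1 or 1/p - 1.
   Elements fixing oo along the orbit have determinant 1, so on leaving the
   stabiliser of oo the orbit enters W at p = -1 with determinant -1.

   Conversely, g in W has two possible predecessors under the algorithm: T g,
   with x-value y + 1 > 1, and eps T g, with x-value 1/(y + 1) in (0, 1).  For
   g in W \ W1 with p < -1 one of them is again in W \ W1: T g if p < -2,
   eps T g if p > -2, and at p = -2 the determinant decides.  With g(oo) = a/c,
   the quantity |a| + |c| strictly decreases, because a and c have opposite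
   signs and |a| >= |c|.  At p = -1 the predecessor eps T g fixes oo, has
   determinant 1 and maps x into (0, 1); only one translation does this, and
   the algorithm reaches it.  Elements of W1 correspond in the same way to the
   unique map -z + n sending x into (0, 1). *)
Require Import Defs.
From mathcomp Require Import all_boot all_order all_algebra.
From mathcomp Require Import all_classical reals.
From mathcomp Require Import ring lra zify.
Set Implicit Arguments.
Unset Strict Implicit.
Import Order.TTheory GRing.Theory Num.Theory.
Local Open Scope ring_scope.
Local Open Scope classical_set_scope.

(** * Two-by-two integer matrices and determinants on [PGL2Z] *)

Lemma mx22_eta (A : 'M[int]_2) : A = mx22 (A 0 0) (A 0 1) (A 1 0) (A 1 1).
Proof.
apply/matrixP => i j; rewrite mxE.
have ord2 (k : 'I_2) : k = if k == 0 then 0 else 1.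
  by case: k => [[|[|]]] //= lk; apply: val_inj.
by rewrite [in LHS](ord2 i) [in LHS](ord2 j); case: (i == 0); case: (j == 0).
Qed.

Lemma mulmx22 (A B : 'M[int]_2) i j :
  (A *m B) i j = A i 0 * B 0 j + A i 1 * B 1 j.
Proof.
rewrite mxE !big_ord_recl big_ord0 addr0.
by congr (A i _ * B _ j + A i _ * B _ j); apply: val_inj.
Qed.

Lemma det2 (A : 'M[int]_2) : \det A = A 0 0 * A 1 1 - A 0 1 * A 1 0.
Proof. by rewrite {1}(mx22_eta A) det_mx22. Qed.

Lemma gl_det_pm1 (A : GL2Z) : \det (glmx A) = 1 \/ \det (glmx A) = -1.
Proof.
by have := glmxP A; rewrite unitmxE => /orP[/eqP|/eqP]; auto.
Qed.

Lemma pgl_det_pm1 (g : PGL2Z) : pgl_det g = 1 \/ pgl_det g = -1.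
Proof. exact: gl_det_pm1. Qed.

Lemma pgl_detM (g h : PGL2Z) : pgl_det (g * h)%g = pgl_det g * pgl_det h.
Proof.
rewrite -(pgl_repr g) -(pgl_repr h) /=.
by rewrite [(_ * _)%g]pgl_mulE !pgl_detE det_mulmx.
Qed.

Lemma pgl_det1 : pgl_det 1%g = 1.
Proof. by rewrite [LHS](pgl_detE gl_one) det1. Qed.

Lemma pgl_detT : pgl_det pglT = 1.
Proof. by rewrite pgl_detE det_mx22. Qed.

Lemma pgl_detEps : pgl_det pglEps = -1.
Proof. by rewrite pgl_detE det_mx22. Qed.

Lemma pgl_detTV : pgl_det pglT^-1%g = 1.
Proof. by have := pgl_det1; rewrite -(mulVg pglT) pgl_detM pgl_detT mulr1. Qed.

Lemma mulEpsEps : (pglEps * pglEps)%g = 1%g.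
Proof.
rewrite [(_ * _)%g]pgl_mulE; apply/pglP/pm_eqP; left => /=.
by rewrite [LHS]mx22_eta [RHS]mx22_eta !mulmx22 !mxE.
Qed.

(** Size of g(oo) as a fraction in lowest terms; absolute values make it independent of the sign of
    the representative. *)
Definition height (g : PGL2Z) : nat :=
  (`|glmx (repr g) 0%R 0%R|%N + `|glmx (repr g) 1%R 0%R|%N)%N.

Lemma heightE (A : GL2Z) : height (pgl A) = (`|A 0%R 0%R| + `|A 1%R 0%R|)%N.
Proof.
rewrite /height.
by case/pm_eqP: (repr_pgl A) => ->; rewrite ?mxE ?abszN.
Qed.

Lemma height_Eps (g : PGL2Z) : height (pglEps * g)%g = height g.
Proof.
rewrite -(pgl_repr g) [(_ * _)%g]pgl_mulE !heightE /= !mulmx22 !mxE /=.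
by rewrite !mul0r !mul1r add0r addr0 addnC.
Qed.

(** * The action in homogeneous coordinates *)

Section Action.
Variable R : realType.
Implicit Types (g h : PGL2Z) (p : P1 R) (x y u v : R).

(** In homogeneous coordinates the action is linear, so products need no case split at [Infty]. The
    pair (0, 0) also yields [Infty], hence the nonvanishing conditions below. *)
Definition proj_pt u v : P1 R := if v == 0 then Infty else Fin (u / v).

Lemma proj_ptP p : exists u v, (u != 0) || (v != 0) /\ p = proj_pt u v.
Proof.
case: p => [y|].
  by exists y, 1; rewrite /proj_pt oner_eq0 orbT divr1.
by exists 1, 0; rewrite /proj_pt eqxx oner_eq0.
Qed.

Lemma gl_act_proj (A : GL2Z) u v : (u != 0) || (v != 0) ->
  gl_act A (proj_pt u v) =
  proj_pt ((A 0 0)%:~R * u + (A 0 1)%:~R * v)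
          ((A 1 0)%:~R * u + (A 1 1)%:~R * v).
Proof.
rewrite /proj_pt; have [->|v0] /= := eqVneq v 0.
  rewrite orbF => u0; rewrite !mulr0 !addr0 mulf_eq0 (negPf u0) orbF.
  by case: ifPn => // c0; congr Fin; field; rewrite u0 c0.
move=> _; set a := (A 0 0)%:~R; set b := (A 0 1)%:~R.
set c := (A 1 0)%:~R; set d := (A 1 1)%:~R.
have -> : c * (u / v) + d = (c * u + d * v) / v by field.
rewrite mulf_eq0 invr_eq0 (negPf v0) orbF.
case: ifPn => // cd0; congr Fin; field.
by rewrite v0 cd0.
Qed.

Lemma gl_act_proj_neq0 (A : GL2Z) u v : (u != 0) || (v != 0) ->
  ((A 0 0)%:~R * u + (A 0 1)%:~R * v != 0)
  || ((A 1 0)%:~R * u + (A 1 1)%:~R * v != 0).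
Proof.
set a : R := (A 0 0)%:~R; set b : R := (A 0 1)%:~R.
set c : R := (A 1 0)%:~R; set d : R := (A 1 1)%:~R.
have D0 : a * d - b * c != 0.
  rewrite -!intrM -intrB -det2 intr_eq0.
  by case: (gl_det_pm1 A) => ->.
apply: contraTT; rewrite !negb_or !negbK => /andP[/eqP e1 /eqP e2].
(* Cramer's rule recovers the determinant times [u] and [v] from the image coordinates. *)
have eu : (a * d - b * c) * u = 0.
  by rewrite [LHS](_ : _ = d * (a * u + b * v) - b * (c * u + d * v));
    [rewrite e1 e2 !mulr0 subr0|ring].
have ev : (a * d - b * c) * v = 0.
  by rewrite [LHS](_ : _ = a * (c * u + d * v) - c * (a * u + b * v));
    [rewrite e1 e2 !mulr0 subr0|ring].
by move/eqP: eu; move/eqP: ev; rewrite !mulf_eq0 (negPf D0) /= => -> ->.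
Qed.

Lemma pgl_actM g h p : pgl_act (g * h)%g p = pgl_act g (pgl_act h p).
Proof.
rewrite -(pgl_repr g) -(pgl_repr h) [(_ * _)%g]pgl_mulE !pgl_actE.
have [u [v [uv0 ->]]] := proj_ptP p.
rewrite !gl_act_proj ?gl_act_proj_neq0 //= !mulmx22 !(intrD, intrM).
by congr proj_pt; ring.
Qed.

Lemma pgl_act1 p : pgl_act 1%g p = p.
Proof.
rewrite [LHS](pgl_actE gl_one) /gl_act !mxE /=; case: p => [y|].
  by rewrite mul0r add0r oner_eq0 mul1r addr0 divr1.
by rewrite eqxx.
Qed.

Lemma pgl_actT y : pgl_act pglT (Fin y) = Fin (y + 1).
Proof.
by rewrite pgl_actE /gl_act !mxE /= mul0r add0r oner_eq0 mul1r divr1.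
Qed.

Lemma pgl_actT_infty : pgl_act pglT (Infty : P1 R) = Infty.
Proof. by rewrite pgl_actE /gl_act !mxE /= eqxx. Qed.

Lemma pgl_actTV y : pgl_act pglT^-1%g (Fin y) = Fin (y - 1).
Proof.
by rewrite -[y in LHS](subrK 1) -pgl_actT -pgl_actM mulVg pgl_act1.
Qed.

Lemma pgl_actTV_infty : pgl_act pglT^-1%g (Infty : P1 R) = Infty.
Proof. by rewrite -[in LHS]pgl_actT_infty -pgl_actM mulVg pgl_act1. Qed.

Lemma pgl_actEps y : y != 0 -> pgl_act pglEps (Fin y) = Fin y^-1.
Proof.
move=> y0; rewrite pgl_actE /gl_act !mxE /= mul1r addr0 (negPf y0).
by rewrite mul0r add0r mul1r.
Qed.

Lemma pgl_actEps_infty : pgl_act pglEps (Infty : P1 R) = Fin 0.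
Proof. by rewrite pgl_actE /gl_act !mxE /= oner_eq0 mul0r. Qed.

Lemma pgl_actEps0 : pgl_act pglEps (Fin (0 : R)) = Infty.
Proof. by rewrite pgl_actE /gl_act !mxE /= mulr0 addr0 eqxx. Qed.

(* Quantifying over B avoids carrying a unit proof for the triangular matrix. *)
Lemma stab_inftyP g : pgl_act g (Infty : P1 R) = Infty ->
  exists n : int,
    forall B : GL2Z, glmx B = mx22 (pgl_det g) n 0 1 -> g = pgl B.
Proof.
rewrite -(pgl_repr g) pgl_actE pgl_detE det2; move: (repr g) => A.
rewrite /gl_act; case: ifPn => // + _; rewrite intr_eq0 => /eqP c0.
have := gl_det_pm1 A; rewrite det2 c0 mulr0 subr0 => D1.
have [d1|d1] : A 1 1 = 1 \/ A 1 1 = -1.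
  have /orP[/eqP|/eqP] : A 1 1 \is a GRing.unit; last by right.
    case: D1 => D1; first exact: intUnitRing.unitzPl D1.
    by apply: (@intUnitRing.unitzPl _ (- A 0 0)); rewrite mulNr D1.
  by left.
  exists (A 0 1) => B eB; apply/pglP/pm_eqP; left.
  by rewrite eB [LHS]mx22_eta c0 d1 mulr1.
(* The lower right entry is -1, so the normalised representative is [- A]. *)
exists (- A 0 1) => B eB; apply/pglP/pm_eqP; right.
rewrite eB [LHS]mx22_eta [RHS]mx22_eta c0 d1 mulrN1 !mxE /=.
by rewrite !opprK oppr0.
Qed.

(** * Affine maps fixing infinity and their uniqueness *)

Lemma act_triangular (B : GL2Z) (e n : int) x :
  glmx B = mx22 e n 0 1 ->
  pgl_act (pgl B) (Fin x) = Fin (e%:~R * x + n%:~R).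
Proof.
move=> eB; rewrite pgl_actE /gl_act eB !mxE /=.
by rewrite mul0r add0r oner_eq0 divr1.
Qed.

Lemma triangular_unit (e n : int) :
  e = 1 \/ e = -1 -> mx22 e n 0 1 \in unitmx.
Proof.
by move=> e1; rewrite unitmxE det_mx22 mulr1 mulr0 subr0; case: e1 => ->.
Qed.

(** Both maps are z -> e z + n with the same e, so the two values in (0, 1) differ by an integer of
    absolute value below 1. *)
Lemma stab_infty_inj x g h y z :
  pgl_act g (Infty : P1 R) = Infty -> pgl_act h (Infty : P1 R) = Infty ->
  pgl_det g = pgl_det h ->
  pgl_act g (Fin x) = Fin y -> pgl_act h (Fin x) = Fin z ->
  0 < y < 1 -> 0 < z < 1 -> g = h.
Proof.
move=> /stab_inftyP[n Hn] /stab_inftyP[m Hm] eD gx hx y01 z01.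
have u k := @triangular_unit (pgl_det g) k (pgl_det_pm1 g).
pose M k := MkGL2Z (u k).
have eg : g = pgl (M n) by apply: Hn.
have eh : h = pgl (M m) by apply: Hm; rewrite -eD.
move: gx hx; rewrite {1}eg eh.
rewrite (@act_triangular (M n) (pgl_det g) n) //.
rewrite (@act_triangular (M m) (pgl_det g) m) // => -[ey] [ez].
suff nm : n = m by rewrite eg nm.
have lt1 : `|(n - m)%:~R : R| < 1.
  by rewrite intrB ltr_norml; apply/andP; split; lra.
by move: lt1; rewrite -intr_norm (_ : 1 = 1%:~R) // ltr_int; lia.
Qed.

(** With g(oo) = a/c <= -1 one has |a + c| = |a| - |c|, so the height drops by |c| > 0. *)
Lemma heightT_lt g (p : R) : pgl_act g Infty = Fin p -> p <= -1 ->
  (height (pglT * g)%g < height g)%N.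
Proof.
rewrite -(pgl_repr g) pgl_actE [(_ * _)%g]pgl_mulE !heightE.
move: (repr g) => A; rewrite /gl_act /= !mulmx22 !mxE /=.
case: ifPn => // c0 [<-]; rewrite intr_eq0 in c0.
set a := A 0 0; set c := A 1 0 in c0 *.
have [c_gt0|c_lt0|/eqP] := ltrgtP 0 c; last by rewrite eq_sym (negPf c0).
  rewrite ler_pdivrMr ?ltr0z // mulN1r -mulrNz ler_int; lia.
rewrite ler_ndivrMr ?ltrz0 // mulN1r -mulrNz ler_int; lia.
Qed.

(** * Irrationality and values along the orbit *)

Lemma rationalV y : rational y -> rational y^-1.
Proof. by case=> q _ <-; exists q^-1; rewrite // fmorphV. Qed.

Lemma rationalDz y (n : int) : rational y -> rational (y + n%:~R).
Proof.
by case=> q _ <-; exists (q + n%:~R); rewrite // rmorphD /= ratr_int.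
Qed.

Lemma irrational_neq y (n : int) : irrational y -> y != n%:~R.
Proof.
by move=> iy; apply/eqP => yn; apply: iy; exists n%:~R; rewrite // ratr_int.
Qed.

Lemma irrational_slow_map y : irrational y -> irrational (slow_map y).
Proof.
move=> iy ry; apply: iy; move: ry; rewrite /slow_map.
case: ifP => _; [|case: ifP => _] => ry.
- by have := rationalDz (-1) ry; rewrite mulrN1z addrK.
- by have /rationalV := rationalDz 1 ry; rewrite subrK invrK.
- by have := rationalDz 1 ry; rewrite subrK.
Qed.

Lemma irrational_slow_seq x i : irrational x -> irrational (slow_seq x i).
Proof. by move=> ix; elim: i => //= i; exact: irrational_slow_map. Qed.

Lemma slow_letter_act y :
  pgl_act (slow_letter y) (Fin y) = Fin (slow_map y).
Proof.
rewrite /slow_letter /slow_map; case: ifPn => [_|]; first exact: pgl_actT.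
rewrite -ltNge => y_gt0; case: ifP => _; last exact: pgl_actTV.
by rewrite pgl_actM pgl_actEps ?gt_eqF // pgl_actTV.
Qed.

Lemma slow_eltS x i :
  slow_elt x i.+1 = (slow_letter (slow_seq x i) * slow_elt x i)%g.
Proof. by []. Qed.

Lemma slow_elt_act x i : pgl_act (slow_elt x i) (Fin x) = Fin (slow_seq x i).
Proof.
elim: i => [|i IH]; first exact: pgl_act1.
by rewrite slow_eltS pgl_actM IH slow_letter_act.
Qed.

Lemma slow_letter_le0 y : y <= 0 -> slow_letter y = pglT.
Proof. by rewrite /slow_letter => ->. Qed.

Lemma slow_letter_01 y : 0 < y < 1 -> slow_letter y = (pglT^-1 * pglEps)%g.
Proof.
by move=> /andP[y0 y1]; rewrite /slow_letter leNgt y0 (ltW y1).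
Qed.

Lemma slow_letter_gt1 y : 1 < y -> slow_letter y = (pglT^-1)%g.
Proof.
by move=> y1; rewrite /slow_letter !leNgt y1 (lt_trans ltr01 y1).
Qed.

(** * The orbit stays in the stabiliser of infinity or in W minus W1 *)

(** As determinants are 1 or -1, avoiding [W1] becomes a sign condition at p = -1. *)
Lemma W_diff_W1P x g :
  (W x `\` W1 x) g <->
  exists2 p : R, [/\ pgl_act g Infty = Fin p, p <= -1
               & p = -1 -> pgl_det g = -1]
           & exists2 y, pgl_act g (Fin x) = Fin y & 0 < y.
Proof.
split=> [[[[p gp p1] gx] nW1]|[p [gp p1 pD] gx]].
  exists p => //; split=> // p1E.
  have [D1|//] := pgl_det_pm1 g.
  by case: nW1; split; [split=> //; exists p|rewrite gp p1E].
split; first by split=> //; exists p.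
by move=> [_ []]; rewrite gp => -[/pD ->].
Qed.

(** Since y > 0, only the last two branches occur; both send p <= -1 strictly below -1, where the
    sign condition holds vacuously. *)
Lemma slow_letter_W x h y : irrational y ->
  (W x `\` W1 x) h -> pgl_act h (Fin x) = Fin y ->
  (W x `\` W1 x) (slow_letter y * h)%g.
Proof.
move=> iy /W_diff_W1P[p [hp p1 _] [y' hx y0]] hxy.
move: hx; rewrite hxy => -[E]; rewrite -{y'}E in y0.
apply/W_diff_W1P.
have y1 : y != 1 := irrational_neq 1 iy.
have [lt1|gt1|/eqP] := ltgtP y 1; last by rewrite (negPf y1).
  rewrite slow_letter_01 ?y0 //.
  have p0 : p != 0 by rewrite lt_eqF //; lra.
  have pV : p^-1 < 0 by rewrite invr_lt0; lra.
  have lt1p : p^-1 - 1 < -1 by lra.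
  exists (p^-1 - 1).
    rewrite !pgl_actM hp pgl_actEps // pgl_actTV.
    by split=> [//||E]; [exact: ltW|move: lt1p; rewrite E ltxx].
  exists (y^-1 - 1); last by rewrite subr_gt0 invf_gt1.
  by rewrite !pgl_actM hxy pgl_actEps ?gt_eqF ?pgl_actTV.
have lt1p : p - 1 < -1 by lra.
rewrite slow_letter_gt1 //; exists (p - 1).
  rewrite pgl_actM hp pgl_actTV.
  by split=> [//||E]; [exact: ltW|move: lt1p; rewrite E ltxx].
by exists (y - 1); rewrite ?subr_gt0 // pgl_actM hxy pgl_actTV.
Qed.

(** The entry into W minus W1: T^-1 eps sends oo to -1 and reverses the determinant. *)
Lemma slow_letter_stab x h y : 0 < y < 1 ->
  pgl_act h (Infty : P1 R) = Infty -> pgl_det h = 1 ->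
  pgl_act h (Fin x) = Fin y ->
  (W x `\` W1 x) (slow_letter y * h)%g.
Proof.
move=> y01 hoo Dh hx; rewrite slow_letter_01 //.
case/andP: y01 => y0 y1; apply/W_diff_W1P; exists (-1).
  rewrite !pgl_actM hoo pgl_actEps_infty pgl_actTV sub0r; split=> // _.
  by rewrite !pgl_detM Dh pgl_detTV pgl_detEps mul1r mulr1.
exists (y^-1 - 1); last by rewrite subr_gt0 invf_gt1.
by rewrite !pgl_actM hx pgl_actEps ?gt_eqF ?pgl_actTV.
Qed.

Lemma slow_elt_stab_or_W x i : irrational x ->
  (pgl_act (slow_elt x i) (Infty : P1 R) = Infty /\ pgl_det (slow_elt x i) = 1)
  \/ (W x `\` W1 x) (slow_elt x i).
Proof.
move=> ix; elim: i => [|i IH]; first by left; rewrite pgl_act1 pgl_det1.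
rewrite slow_eltS.
have iy : irrational (slow_seq x i) := irrational_slow_seq ix.
have hx := slow_elt_act x i.
case: IH => [[hoo Dh]|Wh]; last by right; apply: slow_letter_W.
set y := slow_seq x i in iy hx *.
have y0 : y != 0 := irrational_neq 0 iy.
have y1 : y != 1 := irrational_neq 1 iy.
have [yle0|ygt0] := leP y 0.
  left; rewrite slow_letter_le0 // pgl_actM hoo pgl_actT_infty.
  by rewrite pgl_detM pgl_detT Dh.
have [lt1|gt1|/eqP] := ltgtP y 1; last by rewrite (negPf y1).
  by right; apply: slow_letter_stab => //; rewrite ygt0.
left; rewrite slow_letter_gt1 // pgl_actM hoo pgl_actTV_infty.
by rewrite pgl_detM pgl_detTV Dh.
Qed.

(** Outside (0, 1) the algorithm translates by one unit towards it. *)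
Lemma slow_elt_enters_01 x : irrational x ->
  exists i, [/\ pgl_act (slow_elt x i) (Infty : P1 R) = Infty,
    pgl_det (slow_elt x i) = 1 & 0 < slow_seq x i < 1].
Proof.
move=> ix.
(* Each translation shrinks the interval (-n, n + 1), which is (0, 1) at n = 0; irrationality
   excludes the values 0 and 1. *)
have reach (n i : nat) : - n%:R < slow_seq x i < n%:R + 1 ->
    pgl_act (slow_elt x i) (Infty : P1 R) = Infty ->
    pgl_det (slow_elt x i) = 1 ->
    exists i, [/\ pgl_act (slow_elt x i) (Infty : P1 R) = Infty,
      pgl_det (slow_elt x i) = 1 & 0 < slow_seq x i < 1].
  elim: n i => [|n IH] i bnd hoo Dh.
    by exists i; split=> //; move: bnd; rewrite oppr0 add0r.
  have iy : irrational (slow_seq x i) := irrational_slow_seq ix.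
  have y0 : slow_seq x i != 0 := irrational_neq 0 iy.
  have y1 : slow_seq x i != 1 := irrational_neq 1 iy.
  have n0 : 0 <= n%:R :> R by [].
  rewrite -natr1 in bnd.
  have [yle0|ygt0] := leP (slow_seq x i) 0.
    apply: (IH i.+1); rewrite ?slow_eltS.
    - by rewrite /= /slow_map yle0; lra.
    - by rewrite slow_letter_le0 // pgl_actM hoo pgl_actT_infty.
    - by rewrite slow_letter_le0 // pgl_detM pgl_detT Dh.
  have [lt1|gt1|/eqP] := ltgtP (slow_seq x i) 1; last by rewrite (negPf y1).
    by exists i; rewrite ygt0.
  apply: (IH i.+1); rewrite ?slow_eltS.
  - by rewrite /= /slow_map !leNgt gt1 ygt0 /=; lra.
  - by rewrite slow_letter_gt1 // pgl_actM hoo pgl_actTV_infty.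
  - by rewrite slow_letter_gt1 // pgl_detM pgl_detTV Dh.
apply: (reach (Num.bound `|x|) 0%N); rewrite ?pgl_act1 ?pgl_det1 //.
have : `|x| < (Num.bound `|x|)%:R by rewrite archi_boundP.
by rewrite ltr_norml /slow_seq /=; lra.
Qed.

(** * Descent through predecessors *)

(** The letter depends only on y = h(x), so once h is on the orbit, g is the element after it. *)
Lemma W_diff_W1_pred x g : (W x `\` W1 x) g ->
  exists h y, [/\ g = (slow_letter y * h)%g, pgl_act h (Fin x) = Fin y &
    ((W x `\` W1 x) h /\ (height h < height g)%N) \/
    [/\ pgl_act h (Infty : P1 R) = Infty, pgl_det h = 1 & 0 < y < 1]].
Proof.
move=> /W_diff_W1P[p [gp p1 pD] [y gx y0]].
have yS0 : 0 < y + 1 by lra.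
have yV : 0 < (y + 1)^-1 < 1 by rewrite invr_gt0 yS0 invf_lt1 //; lra.
have ltT := @heightT_lt g p gp p1.
pose h := (pglEps * (pglT * g))%g.
have hx : pgl_act h (Fin x) = Fin (y + 1)^-1.
  by rewrite !pgl_actM gx pgl_actT pgl_actEps ?gt_eqF.
have gh : g = (slow_letter (y + 1)^-1 * h)%g.
  rewrite slow_letter_01 // -mulgA [X in (_ * X)%g]mulgA.
  by rewrite mulEpsEps mul1g mulKg.
have Dh : pgl_det h = - pgl_det g.
  by rewrite !pgl_detM pgl_detEps pgl_detT mul1r mulN1r.
have [pE|pN1] := eqVneq p (-1).
  exists h, (y + 1)^-1; split=> //; right; split=> //.
    by rewrite !pgl_actM gp pE pgl_actT addNr pgl_actEps0.
  by rewrite Dh pD ?opprK.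
(* The left case uses T g, the right case eps T g. At p = -2 both send oo to -1; T keeps the
   determinant and eps T reverses it, so exactly one attains -1. *)
have [[p2 p2D]|np2] :
    (p + 1 <= -1 /\ (p + 1 = -1 -> pgl_det g = -1)) \/
    (-1 <= p + 1 /\ (p + 1 = -1 -> pgl_det g = 1)).
- have [lt2|gt2|_] := ltgtP (p + 1) (-1).
  + by left; split=> // E; move: lt2; rewrite E ltxx.
  + by right; split=> // E; move: gt2; rewrite E ltxx.
  + by case: (pgl_det_pm1 g); [right|left].
- exists (pglT * g)%g, (y + 1); split.
  + by rewrite slow_letter_gt1 ?mulKg //; lra.
  + by rewrite pgl_actM gx pgl_actT.
  left; split=> //; apply/W_diff_W1P; exists (p + 1).
    by rewrite pgl_actM gp pgl_actT pgl_detM pgl_detT mul1r.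
  by exists (y + 1) => //; rewrite pgl_actM gx pgl_actT.
have [p2 p2D] := np2.
exists h, (y + 1)^-1; split=> //; left; split; last by rewrite /h height_Eps.
have pS0 : p + 1 < 0 by lra.
apply/W_diff_W1P; exists (p + 1)^-1; last by exists (y + 1)^-1; case/andP: yV.
split; first by rewrite !pgl_actM gp pgl_actT pgl_actEps ?lt_eqF.
  by rewrite -[leRHS]invrN1 lef_nV2 ?negrE ?oppr_lt0.
by move=> E; rewrite Dh p2D // -[LHS]invrK E invrN1.
Qed.

(** Strong induction on the height, stepping back until oo is fixed. *)
Lemma W_diff_W1_slow x g : irrational x -> (W x `\` W1 x) g -> slow_set x g.
Proof.
move=> ix; have [n] := ubnP (height g); elim: n g => // n IH g ltn Wg.
have [h [y [gE hx [[Wh lth]|[hoo Dh y01]]]]] := W_diff_W1_pred Wg.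
  have [i _ hE] := IH h (leq_trans lth ltn) Wh.
  move: hx; rewrite gE hE slow_elt_act => -[<-].
  by exists i.+1.
have [i [ioo Di xi01]] := slow_elt_enters_01 ix.
exists i.+1 => //; rewrite gE slow_eltS.
have hE : h = slow_elt x i.
  by apply: (stab_infty_inj hoo ioo _ hx (slow_elt_act x i)); rewrite ?Dh.
by move: hx; rewrite {1}hE slow_elt_act => -[<-]; rewrite hE.
Qed.

(** * The single element of [W1] *)

(** Undoing T^-1 eps moves -1 through 0 to oo and turns determinant 1 into -1, which reduces
    uniqueness to [stab_infty_inj]. *)
Lemma W1P x g : W1 x g <->
  exists h y, [/\ g = (pglT^-1 * (pglEps * h))%g,
    pgl_act h (Infty : P1 R) = Infty, pgl_det h = -1,
    pgl_act h (Fin x) = Fin y & 0 < y < 1].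
Proof.
split=> [[[_ [y gx y0]] [gp Dg]]|[h [y [-> hoo Dh hx /andP[y0 y1]]]]].
  exists (pglEps * (pglT * g))%g, (y + 1)^-1.
  have yS0 : 0 < y + 1 by lra.
  rewrite [X in (_ * X)%g]mulgA mulEpsEps mul1g mulKg; split=> //.
  - by rewrite !pgl_actM gp pgl_actT addNr pgl_actEps0.
  - by rewrite !pgl_detM pgl_detEps pgl_detT Dg !mulr1.
  - by rewrite !pgl_actM gx pgl_actT pgl_actEps ?gt_eqF.
  - by rewrite invr_gt0 yS0 invf_lt1 //; lra.
have goo : pgl_act (pglT^-1 * (pglEps * h))%g Infty = Fin (-1 : R).
  by rewrite !pgl_actM hoo pgl_actEps_infty pgl_actTV sub0r.
split; last first.
  by split=> //; rewrite !pgl_detM pgl_detTV pgl_detEps Dh.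
split; first by exists (-1).
exists (y^-1 - 1); last by rewrite subr_gt0 invf_gt1.
by rewrite !pgl_actM hx pgl_actEps ?gt_eqF ?pgl_actTV.
Qed.

Lemma W1_singleton x : irrational x -> exists g, W1 x = [set g].
Proof.
move=> ix.
have [h [hoo Dh [y hx y01]]] : exists h,
    [/\ pgl_act h (Infty : P1 R) = Infty, pgl_det h = -1 &
    exists2 y, pgl_act h (Fin x) = Fin y & 0 < y < 1].
  (* The reflection z -> floor(x) + 1 - z sends the non-integer x into (0, 1). *)
  have u := @triangular_unit (-1) (Num.floor x + 1) (or_intror erefl).
  exists (pgl (MkGL2Z u)); split.
  - by rewrite pgl_actE /gl_act !mxE /= eqxx.
  - by rewrite pgl_detE det_mx22 mulr0 subr0.
  exists ((-1)%:~R * x + (Num.floor x + 1)%:~R); first exact: act_triangular.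
  have lt1 := floorD1_gt x; have le0 := floor_le x.
  have := irrational_neq (Num.floor x) ix; rewrite intrD in lt1 *; lra.
exists (pglT^-1 * (pglEps * h))%g; apply/seteqP; split=> g /=.
  move=> /W1P[k [z [-> koo Dk kx z01]]].
  by rewrite (stab_infty_inj koo hoo _ kx hx) // Dk Dh.
by move=> ->; apply/W1P; exists h, y.
Qed.

End Action.

(** * Comparison of the orbit with W minus W1 *)

Theorem theorem2 (R : realType) (x : R) (x_irr : irrational x) :
  [/\ 0 < x < 1 -> slow_set x = W x `\` W1 x,
      slow_set x `\` stab_infty R = W x `\` W1 x
    & exists g : PGL2Z, W1 x = [set g]].
Proof.
split; last exact: W1_singleton.
- move=> x01; apply/seteqP; split=> g; last exact: W_diff_W1_slow.
  case=> -[//|i] _ ->; elim: i => [|i IH]; rewrite slow_eltS.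
    (* The identity fixes oo and has determinant 1, so for x in (0, 1) the first step already
       enters. *)
    by apply: slow_letter_stab; rewrite ?pgl_act1 ?pgl_det1.
  apply: (slow_letter_W _ IH (slow_elt_act x i.+1)).
  exact: irrational_slow_seq.
- apply/seteqP; split=> g.
    by move=> [[i _ ->]] nstab; case: (slow_elt_stab_or_W i x_irr) => // -[].
  move=> Wg; split; first exact: W_diff_W1_slow.
  by case/W_diff_W1P: Wg => p [gp _ _] _; rewrite /stab_infty /mkset gp.
Qed.
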